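(* Let $(M_1\times_f M_2,F)$ be a twisted product Riemannian manifold and let $f$ be a function on $M_2$ only. Then $(M_1\times_f M_2,F)$ is flat if and only if $(M_1,F_1)$ is flat and the Riemannian curvature of $(M_2,F_2)$ satisfies $$R^{\ \gamma}_{\alpha\ \beta\lambda}=\Big\{\frac{\delta^t N^\gamma_{\alpha\lambda}}{\delta^t u^\beta}+F^\gamma_{\beta\mu}N^\mu_{\alpha\lambda}+N^\gamma_{\beta\mu}F^\mu_{\alpha\lambda}+N^\gamma_{\beta\mu}N^\mu_{\alpha\lambda}\Big\}-\mathfrak C^\beta_\lambda .$$
   Context: Let $(M_1,F_1)$, $(M_2,F_2)$ be Riemannian manifolds, regarded as Finsler manifolds, with local coordinates $(x^i)$, $(u^\alpha)$, fibre coordinates $(y^i)$, $(v^\alpha)$, and metric tensors $g_{ij}(x)$, $g_{\alpha\beta}(u)$ ($F_1^2=g_{ij}y^iy^j$, $F_2^2=g_{\alpha\beta}v^\alpha v^\beta$). For smooth $f:M_1\times M_2\to\mathbb R^+$, the twisted product Riemannian manifold $M_1\times_fM_2$ is $M_1\times M_2$ with $F^2=F_1^2+f^2F_2^2$. ''$f$ is a function on $M_2$ only'' means $\partial f/\partial x^i=0$. Write $f_\alpha=\partial f/\partial u^\alpha$. $F^\gamma_{\alpha\beta}$ denotes the Christoffel symbols of $g_{\alpha\beta}$, and $N^\gamma_{\alpha\beta}=f^{-1}(f_\beta\delta^\gamma_\alpha+f_\alpha\delta^\gamma_\beta-f_\lambda g^{\gamma\lambda}g_{\alpha\beta})$. The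 operator $\frac{\delta^t}{\delta^tu^\beta}=\frac{\partial}{\partial u^\beta}-\mathbf G^j_\beta\frac{\partial}{\partial y^j}-\mathbf G^\mu_\beta\frac{\partial}{\partial v^\mu}$ is the horizontal derivative of $F$, where $\mathbf G^a_b=\partial\mathbf G^a/\partial\mathbf y^b$ and $\mathbf G^a$ are the spray coefficients of $F$; on functions of $(x,u)$ alone it is $\partial/\partial u^\beta$. The curvature convention is $R^{\ \gamma}_{\alpha\ \beta\lambda}=\frac{\partial F^\gamma_{\alpha\beta}}{\partial u^\lambda}-\frac{\partial F^\gamma_{\alpha\lambda}}{\partial u^\beta}+F^\gamma_{\lambda\mu}F^\mu_{\alpha\beta}-F^\gamma_{\beta\mu}F^\mu_{\alpha\lambda}$. $\{\cdots\}-\mathfrak C^\beta_\lambda$ means: subtract from $\{\cdots\}$ the same expression with $\beta$ and $\lambda$ interchanged. Flat means vanishing Riemann curvature tensor. *)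

(* Defs.v *)
From HB Require Import structures.
From mathcomp Require Import all_boot all_order all_algebra.
From mathcomp Require Import all_classical all_reals all_analysis.

Set Implicit Arguments.
Unset Strict Implicit.
Unset Printing Implicit Defensive.

Import Order.TTheory GRing.Theory Num.Theory.
Import numFieldNormedType.Exports.

Local Open Scope classical_set_scope.
Local Open Scope ring_scope.

Section calculus.
Context {R : realType} {n : nat}.
Implicit Types (D : set 'rV[R]_n) (h : 'rV[R]_n -> R).

Definition partial (a : 'I_n) h (x : 'rV[R]_n) : R := 'D_(delta_mx 0 a) h x.

(* [D] is always an open set below. *)
Fixpoint Ck_on (k : nat) D h : Prop :=
  (forall x, D x -> {for x, continuous h}) /\
  match k with
  | 0 => True
  | k'.+1 => forall a : 'I_n,
      (forall x, D x -> derivable h x (delta_mx 0 a)) /\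
      Ck_on k' D (partial a h)
  end.

Definition smooth_on D h : Prop := forall k, Ck_on k D h.

End calculus.

Section calculus_theory.
Context {R : realType}.

Lemma Ck_on_cst n k (D : set 'rV[R]_n) (c : R) : Ck_on k D (fun=> c).
Proof.
elim: k c => [|k IH] c; first by split=> // x _; exact: cst_continuous.
split=> [x _|a]; first exact: cst_continuous.
split=> [x _|]; first exact: derivable_cst.
suff -> : partial a (fun _ : 'rV[R]_n => c) = (fun=> 0) by exact: IH.
by apply/funext => x; rewrite /partial derive_cst.
Qed.

Lemma Ck_on_cont n k (D : set 'rV[R]_n) h :
  Ck_on k D h -> forall x, D x -> {for x, continuous h}.
Proof. by case: k => [|k] []. Qed.

Lemma Ck_on_weak n k (D : set 'rV[R]_n) h : Ck_on k.+1 D h -> Ck_on k D h.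
Proof.
elim: k h => [|k IH] h [hc hd]; split=> // a.
by have [d1 d2] := hd a; split=> //; exact: IH.
Qed.

Lemma Ck_on_ext n k (D : set 'rV[R]_n) h h' : open D ->
  (forall x, D x -> h x = h' x) -> Ck_on k D h -> Ck_on k D h'.
Proof.
move=> oD.
have near_eq g g' (gg' : forall x, D x -> g x = g' x) x :
    D x -> \forall y \near x, g y = g' y :> R.
  by move=> Dx; have := open_nbhs_nbhs (conj oD Dx); apply: filterS => y /gg'.
have cont g g' (gg' : forall x, D x -> g x = g' x) x : D x ->
    {for x, continuous g} -> {for x, continuous (g' : _ -> R)}.
  move=> Dx gc; rewrite /prop_for /continuous_at -(gg' _ Dx).
  by apply: cvg_trans gc; apply: (@near_eq_cvg _ _ (nbhs x) _ g g'); exact: near_eq.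
elim: k h h' => [|k IH] h h' hh' [hc hd].
  by split=> // x Dx; exact: (cont _ _ hh' _ Dx (hc _ Dx)).
split=> [x Dx|a]; first exact: (cont _ _ hh' _ Dx (hc _ Dx)).
have [d1 d2] := hd a; split=> [x Dx|].
  by apply: near_eq_derivable (d1 _ Dx); exact: near_eq.
by apply: IH d2 => x Dx; rewrite /partial; apply: near_eq_derive; exact: near_eq.
Qed.

Lemma Ck_onD n k (D : set 'rV[R]_n) h h' : open D ->
  Ck_on k D h -> Ck_on k D h' -> Ck_on k D (fun x => h x + h' x).
Proof.
move=> oD; elim: k h h' => [|k IH] h h'.
  by move=> [hc _] [h'c _]; split=> // x Dx; apply: continuousD; [exact: hc|exact: h'c].
move=> [hc hd] [h'c h'd]; split=> [x Dx|a].
  by apply: continuousD; [exact: hc|exact: h'c].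
have [d1 d2] := hd a; have [d1' d2'] := h'd a; split=> [x Dx|].
  by apply: derivableD; [exact: d1|exact: d1'].
apply: Ck_on_ext (IH _ _ d2 d2') => // x Dx; rewrite /partial.
by rewrite -deriveD; [|exact: d1|exact: d1'].
Qed.

Lemma Ck_onM n k (D : set 'rV[R]_n) h h' : open D ->
  Ck_on k D h -> Ck_on k D h' -> Ck_on k D (fun x => h x * h' x).
Proof.
move=> oD; elim: k h h' => [|k IH] h h'.
  by move=> [hc _] [h'c _]; split=> // x Dx; apply: continuousM; [exact: hc|exact: h'c].
move=> H H'; have [hc hd] := H; have [h'c h'd] := H'; split=> [x Dx|a].
  by apply: continuousM; [exact: hc|exact: h'c].
have [d1 d2] := hd a; have [d1' d2'] := h'd a; split=> [x Dx|].
  by apply: derivableM; [exact: d1|exact: d1'].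
apply: (@Ck_on_ext _ _ _ (fun x => h x * partial a h' x + h' x * partial a h x)) => //.
  by move=> x Dx; rewrite /partial -deriveM; [|exact: d1|exact: d1'].
by apply: Ck_onD => //; [apply: IH => //|apply: IH => //]; exact: Ck_on_weak.
Qed.

Lemma Ck_onS n k (D D' : set 'rV[R]_n) h :
  D' `<=` D -> Ck_on k D h -> Ck_on k D' h.
Proof.
move=> DD'; elim: k h => [|k IH] h [hc hd]; first by split=> // x /DD'/hc.
split=> [x /DD'/hc//|a].
by have [d1 d2] := hd a; split=> [x /DD'/d1//|]; exact: IH.
Qed.

Section linear_substitution.
Context {m n : nat} (L : {linear 'rV[R]_m -> 'rV[R]_n}) (a : 'I_m).
Implicit Types h : 'rV[R]_n -> R.

Let quotient_linear h b x : L (delta_mx 0 a) = delta_mx 0 b ->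
  (fun t : R => t^-1 *: (((h \o L) \o shift x) (t *: delta_mx 0 a) - (h \o L) x)) =
  (fun t : R => t^-1 *: ((h \o shift (L x)) (t *: delta_mx 0 b) - h (L x))).
Proof. by move=> La; apply/funext => t /=; rewrite linearP La. Qed.

Let quotient_linear0 h x : L (delta_mx 0 a) = 0 ->
  (fun t : R => t^-1 *: (((h \o L) \o shift x) (t *: delta_mx 0 a) - (h \o L) x)) =
  (fun=> 0).
Proof.
by move=> La; apply/funext => t /=; rewrite linearP La scaler0 add0r subrr scaler0.
Qed.

Lemma partial_linear h b x : L (delta_mx 0 a) = delta_mx 0 b ->
  partial a (h \o L) x = partial b h (L x).
Proof. by move=> La; rewrite /partial /derive (quotient_linear h x La). Qed.

Lemma derivable_linear h b x : L (delta_mx 0 a) = delta_mx 0 b ->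
  derivable h (L x) (delta_mx 0 b) -> derivable (h \o L) x (delta_mx 0 a).
Proof. by move=> La; rewrite /derivable (quotient_linear h x La). Qed.

Lemma is_derive_linear0 h x : L (delta_mx 0 a) = 0 ->
  is_derive x (delta_mx 0 a) (h \o L) 0.
Proof.
move=> La; split; rewrite /derivable /derive (quotient_linear0 h x La).
- exact: is_cvg_cst.
- by rewrite lim_cst//; exact: norm_hausdorff.
Qed.

End linear_substitution.

Lemma Ck_on_linear m n (L : {linear 'rV[R]_m -> 'rV[R]_n}) k D h :
  continuous L ->
  (forall a, L (delta_mx 0 a) = 0 \/ exists b, L (delta_mx 0 a) = delta_mx 0 b) ->
  Ck_on k D h -> Ck_on k (L @^-1` D) (h \o L).
Proof.
move=> Lc La; elim: k h => [|k IH] h [hc hd].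
  by split=> // x Dx; apply: continuous_comp; [exact: Lc|exact: hc].
split=> [x Dx|a]; first by apply: continuous_comp; [exact: Lc|exact: hc].
have [L0|[b Lb]] := La a.
  split=> [x Dx|]; first by have [] := is_derive_linear0 h x L0.
  suff -> : partial a (h \o L) = fun=> 0 by exact: Ck_on_cst.
  by apply/funext => x; have [_] := is_derive_linear0 h x L0.
have [d1 d2] := hd b; split=> [x Dx|]; first exact: derivable_linear Lb (d1 _ Dx).
suff -> : partial a (h \o L) = partial b h \o L by exact: IH.
by apply/funext => x; exact: partial_linear.
Qed.

Section projections.
Context {n1 n2 : nat}.
Local Notation V := 'rV[R]_(n1 + n2).

Lemma lsubmx_delta_l (a : 'I_n1) :
  lsubmx (delta_mx 0 (lshift n2 a) : V) = delta_mx 0 a.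
Proof. by apply/rowP => b; rewrite !mxE (inj_eq (@lshift_inj _ _)). Qed.

Lemma lsubmx_delta_r (a : 'I_n2) : lsubmx (delta_mx 0 (rshift n1 a) : V) = 0.
Proof. by apply/rowP => b; rewrite !mxE eq_lrshift. Qed.

Lemma rsubmx_delta_l (a : 'I_n1) : rsubmx (delta_mx 0 (lshift n2 a) : V) = 0.
Proof. by apply/rowP => b; rewrite !mxE eq_rlshift. Qed.

Lemma rsubmx_delta_r (a : 'I_n2) :
  rsubmx (delta_mx 0 (rshift n1 a) : V) = delta_mx 0 a.
Proof. by apply/rowP => b; rewrite !mxE (inj_eq (@rshift_inj _ _)). Qed.

Lemma smooth_on_lsubmx D (h : 'rV[R]_n1 -> R) : smooth_on D h ->
  smooth_on [set z : V | D (lsubmx z)] (fun z : V => h (lsubmx z)).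
Proof.
move=> sh k; apply: (Ck_on_linear (L := lsubmx)) (sh k).
  exact: continuous_lsubmx.
move=> a; case: (splitP a) => b ab.
  by right; exists b; rewrite -lsubmx_delta_l; congr (lsubmx (delta_mx _ _)); exact/val_inj.
by left; rewrite -(lsubmx_delta_r b); congr (lsubmx (delta_mx _ _)); exact/val_inj.
Qed.

Lemma smooth_on_rsubmx D (h : 'rV[R]_n2 -> R) : smooth_on D h ->
  smooth_on [set z : V | D (rsubmx z)] (fun z : V => h (rsubmx z)).
Proof.
move=> sh k; apply: (Ck_on_linear (L := rsubmx)) (sh k).
  exact: continuous_rsubmx.
move=> a; case: (splitP a) => b ab.
  by left; rewrite -(rsubmx_delta_l b); congr (rsubmx (delta_mx _ _)); exact/val_inj.
by right; exists b; rewrite -rsubmx_delta_r; congr (rsubmx (delta_mx _ _)); exact/val_inj.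
Qed.

Lemma partial_lsubmx_l (a : 'I_n1) h (z : V) :
  partial (lshift n2 a) (fun z : V => h (lsubmx z)) z = partial a h (lsubmx z).
Proof. exact: (partial_linear (L := lsubmx) h z (lsubmx_delta_l a)). Qed.

Lemma partial_lsubmx_r (a : 'I_n2) h (z : V) :
  partial (rshift n1 a) (fun z : V => h (lsubmx z)) z = 0.
Proof. by have [_] := is_derive_linear0 (L := lsubmx) h z (lsubmx_delta_r a). Qed.

Lemma partial_rsubmx_l (a : 'I_n1) h (z : V) :
  partial (lshift n2 a) (fun z : V => h (rsubmx z)) z = 0.
Proof. by have [_] := is_derive_linear0 (L := rsubmx) h z (rsubmx_delta_l a). Qed.

Lemma partial_rsubmx_r (a : 'I_n2) h (z : V) :
  partial (rshift n1 a) (fun z : V => h (rsubmx z)) z = partial a h (rsubmx z).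
Proof. exact: (partial_linear (L := rsubmx) h z (rsubmx_delta_r a)). Qed.

End projections.
End calculus_theory.

Section manifolds.
Context {R : realType}.

Record chart (n : nat) (M : topologicalType) := Chart {
  cdom : set M;
  cmap : M -> 'rV[R]_n;
  cinv : 'rV[R]_n -> M;
  cdom_open : open cdom;
  cimg_open : open (cmap @` cdom);
  cmapK : forall p, cdom p -> cinv (cmap p) = p;
  cmap_cont : forall p, cdom p -> {for p, continuous cmap};
  cinv_cont : forall x, (cmap @` cdom) x -> {for x, continuous cinv} }.

Definition cimg n M (c : chart n M) : set 'rV[R]_n := cmap c @` cdom c.

Definition overlap n M (c d : chart n M) : set 'rV[R]_n :=
  cmap c @` (cdom c `&` cdom d).

Definition transition n M (c d : chart n M) (x : 'rV[R]_n) : 'rV[R]_n :=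
  cmap d (cinv c x).

Record manifold (n : nat) := Manifold {
  mpoints :> topologicalType;
  mhausdorff : hausdorff_space mpoints;
  msecond_countable : @second_countable mpoints;
  (* With an empty factor a product would be vacuously flat. *)
  mnonempty : [set: mpoints] !=set0;
  mindex : Type;
  mchart : mindex -> chart n mpoints;
  mcover : forall p, exists i, cdom (mchart i) p;
  mtransition : forall i j (b : 'I_n),
    smooth_on (overlap (mchart i) (mchart j))
      (fun x => transition (mchart i) (mchart j) x 0 b) }.

Definition local n (M : manifold n) (f : M -> R) (i : mindex M)
  (x : 'rV[R]_n) : R := f (cinv (mchart i) x).

Definition smooth n (M : manifold n) (f : M -> R) : Prop :=
  forall i, smooth_on (cimg (mchart i)) (local f i).

Definition jacobian_mx n (t : 'rV[R]_n -> 'rV[R]_n) (x : 'rV[R]_n) : 'M[R]_n :=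
  \matrix_(a, b) partial a (fun y => t y 0 b) x.

(* A Riemannian metric is given by its components [metric i x a b] = g_ab(x)
   in each chart of the atlas, related by the tensor transformation law. *)
Record riemannian (n : nat) := Riemannian {
  rmanifold :> manifold n;
  metric : mindex rmanifold -> 'rV[R]_n -> 'M[R]_n;
  metric_sym : forall i x, cimg (mchart i) x -> (metric i x)^T = metric i x;
  metric_pos : forall i x, cimg (mchart i) x ->
    forall v : 'rV[R]_n, v != 0 -> 0 < (v *m metric i x *m v^T) 0 0;
  metric_smooth : forall i (a b : 'I_n),
    smooth_on (cimg (mchart i)) (fun x => metric i x a b);
  metric_transition : forall i j x,
    overlap (mchart i) (mchart j) x ->
    let t := transition (mchart i) (mchart j) in
    metric i x = jacobian_mx t x *m metric j (t x) *m (jacobian_mx t x)^T }.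

End manifolds.

Arguments chart : clear implicits.
Arguments manifold : clear implicits.
Arguments riemannian : clear implicits.

Section coordinate_geometry.
Context {R : realType} {n : nat}.
Implicit Types (g : 'rV[R]_n -> 'M[R]_n) (F : 'rV[R]_n -> 'rV[R]_n -> R).
Implicit Types (x y : 'rV[R]_n) (a b c l : 'I_n).

(* [christoffel g x c a b] is Gamma^c_ab. *)
Definition christoffel g x c a b : R :=
  2^-1 * \sum_d invmx (g x) c d *
    (partial a (fun z => g z b d) x + partial b (fun z => g z a d) x
     - partial d (fun z => g z a b) x).

(* [curvature g x a c b l] is R_a^c_bl. *)
Definition curvature g x a c b l : R :=
  partial l (fun z => christoffel g z c a b) x
  - partial b (fun z => christoffel g z c a l) x
  + \sum_m christoffel g x c l m * christoffel g x m a b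
  - \sum_m christoffel g x c b m * christoffel g x m a l.

Definition norm_of_metric g x y : R := Num.sqrt ((y *m g x *m y^T) 0 0).

Definition fundamental_tensor F x y : 'M[R]_n :=
  \matrix_(a, b) (2^-1 * partial a (partial b (fun w => F x w ^+ 2)) y).

Definition spray F a x y : R :=
  4^-1 * \sum_b invmx (fundamental_tensor F x y) a b *
    (\sum_c partial c (fun z => partial b (fun w => F z w ^+ 2) y) x * y 0 c
     - partial b (fun z => F z y ^+ 2) x).

(* [connection F a b] is G^a_b, the derivative of G^a with respect to y^b. *)
Definition connection F a b x y : R := partial b (spray F a x) y.

End coordinate_geometry.

Definition finsler R n (M : riemannian R n) (i : mindex M)
  (x y : 'rV[R]_n) : R := norm_of_metric (metric i) x y.

Definition flat R n (M : riemannian R n) : Prop :=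
  forall (i : mindex M) x, cimg (mchart i) x ->
  forall a c b l : 'I_n, curvature (metric i) x a c b l = 0.

Section product_manifold.
Context {R : realType} {n1 n2 : nat}.

Lemma continuous_row_mx (T : topologicalType) (f : T -> 'rV[R]_n1)
    (g : T -> 'rV[R]_n2) p : {for p, continuous f} -> {for p, continuous g} ->
  {for p, continuous (fun q => row_mx (f q) (g q))}.
Proof.
move=> fc gc; apply/cvg_ballP => e e0.
move/cvg_ballP : fc => /(_ e e0) fe; move/cvg_ballP : gc => /(_ e e0) ge.
near=> q; split=> // i j.
have [_ fq] : ball (f p) e (f q) by near: q.
have [_ gq] : ball (g p) e (g q) by near: q.
by rewrite !mxE; case: (fintype.split j) => b; [exact: fq|exact: gq].
Unshelve. all: by end_near. Qed.

Section prod_chart.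
Context {M1 M2 : topologicalType} (c1 : chart R n1 M1) (c2 : chart R n2 M2).

Let dom : set (M1 * M2) := [set p | cdom c1 p.1 /\ cdom c2 p.2].
Let map (p : M1 * M2) : 'rV[R]_(n1 + n2) := row_mx (cmap c1 p.1) (cmap c2 p.2).
Let inv (z : 'rV[R]_(n1 + n2)) : M1 * M2 :=
  (cinv c1 (lsubmx z), cinv c2 (rsubmx z)).

Let imgE : map @` dom =
  [set z | cimg c1 (lsubmx z) /\ cimg c2 (rsubmx z)].
Proof.
apply/seteqP; split=> z /=.
  move=> [[p q] [/= dp dq] <-]; rewrite /map row_mxKl row_mxKr.
  by split; [exists p|exists q].
move=> [[p dp pz] [q dq qz]]; exists (p, q) => //.
by rewrite /map /= pz qz hsubmxK.
Qed.

Let dom_open : open dom.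
Proof.
apply: (@openI _ (fst @^-1` cdom c1) (snd @^-1` cdom c2)).
- by apply: open_comp (cdom_open c1) => p _; exact: cvg_fst.
- by apply: open_comp (cdom_open c2) => p _; exact: cvg_snd.
Qed.

Let img_open : open (map @` dom).
Proof.
rewrite imgE; apply: (@openI _ (lsubmx @^-1` cimg c1) (rsubmx @^-1` cimg c2)).
- by apply: open_comp; [move=> z _; exact: continuous_lsubmx|exact: cimg_open].
- by apply: open_comp; [move=> z _; exact: continuous_rsubmx|exact: cimg_open].
Qed.

Let mapK p : dom p -> inv (map p) = p.
Proof.
by case: p => p q [/= dp dq]; rewrite /inv row_mxKl row_mxKr !cmapK.
Qed.

Let map_cont p : dom p -> {for p, continuous map}.
Proof.
move=> [d1 d2]; apply: continuous_row_mx.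
- by apply: (@continuous_comp _ _ _ fst); [exact: cvg_fst|exact: cmap_cont].
- by apply: (@continuous_comp _ _ _ snd); [exact: cvg_snd|exact: cmap_cont].
Qed.

Let inv_cont z : (map @` dom) z -> {for z, continuous inv}.
Proof.
rewrite imgE => -[z1 z2].
have h1 : {for z, continuous (cinv c1 \o lsubmx : 'rV[R]_(n1 + n2) -> M1)}.
  by apply: continuous_comp; [exact: continuous_lsubmx|exact: cinv_cont].
have h2 : {for z, continuous (cinv c2 \o rsubmx : 'rV[R]_(n1 + n2) -> M2)}.
  by apply: continuous_comp; [exact: continuous_rsubmx|exact: cinv_cont].
exact: (cvg_pair h1 h2).
Qed.

Definition prod_chart : chart R (n1 + n2) (M1 * M2)%type :=
  Chart dom_open img_open mapK map_cont inv_cont.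

Lemma cimg_prodE : cimg prod_chart =
  [set z | cimg c1 (lsubmx z) /\ cimg c2 (rsubmx z)].
Proof. exact: imgE. Qed.

End prod_chart.

Lemma overlap_prodE (M1 M2 : topologicalType) (c1 d1 : chart R n1 M1)
    (c2 d2 : chart R n2 M2) :
  overlap (prod_chart c1 c2) (prod_chart d1 d2) =
  [set z | overlap c1 d1 (lsubmx z) /\ overlap c2 d2 (rsubmx z)].
Proof.
apply/seteqP; split=> z /=.
  move=> [[p q] [/= [c1p c2q] [d1p d2q]] <-]; rewrite row_mxKl row_mxKr.
  by split; [exists p|exists q].
move=> [[p dp pz] [q dq qz]]; exists (p, q); last by rewrite /= pz qz hsubmxK.
by case: dp dq => ? ? [].
Qed.

Lemma hausdorff_prod (T U : topologicalType) :
  hausdorff_space T -> hausdorff_space U -> hausdorff_space (T * U)%type.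
Proof.
move=> hT hU [p1 p2] [q1 q2] pq; congr pair.
- apply: hT => A B pA qB; have [] := pq (fst @^-1` A) (fst @^-1` B).
  + exact: (@cvg_fst _ _ (nbhs p1) (nbhs p2)).
  + exact: (@cvg_fst _ _ (nbhs q1) (nbhs q2)).
  by move=> [x y] [/= xA xB]; exists x.
- apply: hU => A B pA qB; have [] := pq (snd @^-1` A) (snd @^-1` B).
  + exact: (@cvg_snd _ _ (nbhs p1) (nbhs p2)).
  + exact: (@cvg_snd _ _ (nbhs q1) (nbhs q2)).
  by move=> [x y] [/= xA xB]; exists y.
Qed.

Lemma second_countable_prod (T U : topologicalType) :
  @second_countable T -> @second_countable U -> @second_countable (T * U)%type.
Proof.
move=> [B cB [oB bB]] [C cC [oC bC]].
exists [set X.1 `*` X.2 | X in B `*` C].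
  exact: sub_countable (card_image_le _ _) (countableX cB cC).
split.
  move=> _ [[X Y] [/= /oB oX /oC oY] <-].
  apply: (@openI _ (fst @^-1` X) (snd @^-1` Y)).
  - by apply: open_comp oX => p _; exact: cvg_fst.
  - by apply: open_comp oY => p _; exact: cvg_snd.
move=> [p q] A [[P Q] /= [pP qQ] PQA].
have [X [BX Xp] XP] := bB p P pP; have [Y [CY Yq] YQ] := bC q Q qQ.
exists (X `*` Y) => /=; first by split=> //; exists (X, Y).
by move=> [r s] [/= /XP Pr /YQ Qs]; exact: PQA.
Qed.

Context (M1 : manifold R n1) (M2 : manifold R n2).

Let pchart (k : mindex M1 * mindex M2) := prod_chart (mchart k.1) (mchart k.2).

Let pcover p : exists k, cdom (pchart k) p.
Proof. by have [i ip] := mcover p.1; have [j jp] := mcover p.2; exists (i, j). Qed.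

Let pnonempty : [set: M1 * M2] !=set0.
Proof. by have [p _] := mnonempty M1; have [q _] := mnonempty M2; exists (p, q). Qed.

Lemma prod_transition_l (k l : mindex M1 * mindex M2) z b :
  transition (pchart k) (pchart l) z 0 (lshift n2 b) =
  transition (mchart k.1) (mchart l.1) (lsubmx z) 0 b.
Proof. by rewrite /transition /= row_mxEl. Qed.

Lemma prod_transition_r (k l : mindex M1 * mindex M2) z b :
  transition (pchart k) (pchart l) z 0 (rshift n1 b) =
  transition (mchart k.2) (mchart l.2) (rsubmx z) 0 b.
Proof. by rewrite /transition /= row_mxEr. Qed.

Let ptransition k l b : smooth_on (overlap (pchart k) (pchart l))
  (fun x => transition (pchart k) (pchart l) x 0 b).
Proof.
rewrite -(splitK b); case: (fintype.split b) => a m /=.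
- under eq_fun do rewrite prod_transition_l.
  apply: Ck_onS (smooth_on_lsubmx (mtransition k.1 l.1 a) m) => z.
  by rewrite overlap_prodE => -[].
- under eq_fun do rewrite prod_transition_r.
  apply: Ck_onS (smooth_on_rsubmx (mtransition k.2 l.2 a) m) => z.
  by rewrite overlap_prodE => -[].
Qed.

Definition prod_manifold : manifold R (n1 + n2) :=
  Manifold (hausdorff_prod (@mhausdorff _ _ M1) (@mhausdorff _ _ M2))
    (second_countable_prod (@msecond_countable _ _ M1) (@msecond_countable _ _ M2))
    pnonempty pcover ptransition.

End product_manifold.

Section twisted_product.
Context {R : realType} {n1 n2 : nat}.
Context (M1 : riemannian R n1) (M2 : riemannian R n2).
Context (f : prod_manifold M1 M2 -> R).
Context (f_smooth : smooth f) (f_gt0 : forall p, 0 < f p).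

Let P := prod_manifold M1 M2.

Let tmetric (k : mindex P) (z : 'rV[R]_(n1 + n2)) : 'M[R]_(n1 + n2) :=
  block_mx (metric k.1 (lsubmx z)) 0
           0 (local f k z ^+ 2 *: metric k.2 (rsubmx z)).

Let tmetric_sym k z : cimg (mchart k) z -> (tmetric k z)^T = tmetric k z.
Proof.
rewrite cimg_prodE => -[z1 z2].
by rewrite /tmetric tr_block_mx !trmx0 linearZ /= !metric_sym.
Qed.

Let tmetric_quad k z (v : 'rV[R]_(n1 + n2)) :
  (v *m tmetric k z *m v^T) 0 0 =
  (lsubmx v *m metric k.1 (lsubmx z) *m (lsubmx v)^T) 0 0 +
  local f k z ^+ 2 *
    (rsubmx v *m metric k.2 (rsubmx z) *m (rsubmx v)^T) 0 0.
Proof.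
rewrite -{1 2}(hsubmxK v) /tmetric mul_row_block !mulmx0 addr0 add0r.
by rewrite tr_row_mx mul_row_col -scalemxAr -scalemxAl !mxE.
Qed.

Let quad_ge0 n (M : riemannian R n) (i : mindex M) x (v : 'rV[R]_n) :
  cimg (mchart i) x -> 0 <= (v *m metric i x *m v^T) 0 0.
Proof.
move=> ix; have [->|/(metric_pos ix)/ltW//] := eqVneq v 0.
by rewrite !mul0mx mxE.
Qed.

Let tmetric_pos k z : cimg (mchart k) z ->
  forall v : 'rV[R]_(n1 + n2), v != 0 -> 0 < (v *m tmetric k z *m v^T) 0 0.
Proof.
rewrite cimg_prodE => /= -[z1 z2] v v0; rewrite tmetric_quad.
have f2 : 0 < local f k z ^+ 2 by apply: exprn_gt0; exact: f_gt0.
have [l0|l0] := eqVneq (lsubmx v) 0; last first.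
  by rewrite ltr_pwDl ?metric_pos// mulr_ge0 ?quad_ge0// ltW.
rewrite ltr_wpDl ?quad_ge0// mulr_gt0// metric_pos//.
by apply: contraNneq v0 => r0; rewrite -(hsubmxK v) l0 r0 row_mx0.
Qed.

Let tmetric_smooth k a b :
  smooth_on (cimg (mchart k)) (fun z => tmetric k z a b).
Proof.
rewrite -(splitK a) -(splitK b) => m.
have oimg : open (cimg (mchart k)) by exact: cimg_open.
case: (fintype.split a) => {}a; case: (fintype.split b) => {}b /=.
- under eq_fun do rewrite block_mxEul.
  apply: Ck_onS (smooth_on_lsubmx (metric_smooth k.1 a b) m) => z.
  by rewrite cimg_prodE => -[].
- under eq_fun do rewrite block_mxEur mxE.
  exact: Ck_on_cst.
- under eq_fun do rewrite block_mxEdl mxE.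
  exact: Ck_on_cst.
- under eq_fun do rewrite block_mxEdr mxE expr2.
  do 2?[apply: Ck_onM => //]; try exact: f_smooth.
  apply: Ck_onS (smooth_on_rsubmx (metric_smooth k.2 a b) m) => z.
  by rewrite cimg_prodE => -[].
Qed.

Let tjacobian k l z :
  jacobian_mx (transition (mchart (k : mindex P)) (mchart l)) z =
  block_mx (jacobian_mx (transition (mchart k.1) (mchart l.1)) (lsubmx z)) 0
           0 (jacobian_mx (transition (mchart k.2) (mchart l.2)) (rsubmx z)).
Proof.
apply/matrixP => a b; rewrite -(splitK a) -(splitK b).
case: (fintype.split a) => {}a; case: (fintype.split b) => {}b /=; rewrite mxE.
- rewrite block_mxEul mxE; under eq_fun do rewrite prod_transition_l.
  exact: (partial_lsubmx_l a (fun x => transition _ _ x 0 b)).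
- rewrite block_mxEur mxE; under eq_fun do rewrite prod_transition_r.
  exact: (partial_rsubmx_l a (fun x => transition _ _ x 0 b)).
- rewrite block_mxEdl mxE; under eq_fun do rewrite prod_transition_l.
  exact: (partial_lsubmx_r a (fun x => transition _ _ x 0 b)).
- rewrite block_mxEdr mxE; under eq_fun do rewrite prod_transition_r.
  exact: (partial_rsubmx_r a (fun x => transition _ _ x 0 b)).
Qed.

Let tmetric_transition k l z : overlap (mchart k) (mchart l) z ->
  let t := transition (mchart k) (mchart l) in
  tmetric k z = jacobian_mx t z *m tmetric l (t z) *m (jacobian_mx t z)^T.
Proof.
move=> kl t; have ft : local f l (t z) = local f k z.
  have [p [kp lp] <-] := kl.
  by rewrite /local /t /transition cmapK// cmapK.
move: kl; rewrite overlap_prodE => -[kl1 kl2].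
rewrite tjacobian /tmetric ft tr_block_mx !trmx0 !mulmx_block.
rewrite !(mulmx0, mul0mx, addr0, add0r).
rewrite (metric_transition kl1) (metric_transition kl2).
rewrite -scalemxAr -scalemxAl /t /transition /= row_mxKl row_mxKr.
by rewrite ?mulmx0 ?mul0mx.
Qed.

Definition twisted_product : riemannian R (n1 + n2) :=
  Riemannian tmetric_sym tmetric_pos tmetric_smooth tmetric_transition.

Lemma finsler_twisted_product (k : mindex twisted_product) z w :
  cimg (mchart k) z ->
  finsler k z w ^+ 2 =
  finsler k.1 (lsubmx z) (lsubmx w) ^+ 2
  + local f k z ^+ 2 * finsler k.2 (rsubmx z) (rsubmx w) ^+ 2.
Proof.
move=> kz; rewrite /finsler /norm_of_metric sqr_sqrtr ?quad_ge0//.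
by move: kz; rewrite cimg_prodE => -[z1 z2]; rewrite !sqr_sqrtr ?quad_ge0 ?tmetric_quad.
Qed.

End twisted_product.

Section twisted_product_coordinates.
Context {R : realType} {n1 n2 : nat}.
Local Notation V := 'rV[R]_(n1 + n2).

(* [fc] and [g] are the expressions of f and of the metric of the second factor
   in a product chart; [twist_tensor fc g z c a b] is N^c_ab. *)
Definition twist_tensor (fc : V -> R) (g : 'rV[R]_n2 -> 'M[R]_n2) (z : V)
    (c a b : 'I_n2) : R :=
  let fd l := partial (rshift n1 l) fc z in
  let gu := g (rsubmx z) in
  (fc z)^-1 * (fd b * (c == a)%:R + fd a * (c == b)%:R
               - \sum_l fd l * invmx gu c l * gu a b).

(* The horizontal derivative along u^b of a function [H z w] of the position
   z = (x, u) and of the fibre variable w = (y, v). *)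
Definition horizontal_u (F : V -> V -> R) (b : 'I_n2) (H : V -> V -> R)
    (z w : V) : R :=
  partial (rshift n1 b) (fun z' => H z' w) z
  - \sum_(j < n1) connection F (lshift n2 j) (rshift n1 b) z w *
                  partial (lshift n2 j) (H z) w
  - \sum_(m < n2) connection F (rshift n1 m) (rshift n1 b) z w *
                  partial (rshift n1 m) (H z) w.

Lemma horizontal_u_base F b (h : V -> R) z w :
  horizontal_u F b (fun z _ => h z) z w = partial (rshift n1 b) h z.
Proof.
rewrite /horizontal_u !big1 ?subr0// => j _;
  by rewrite /partial (derive_cst (h z)) mulr0.
Qed.

End twisted_product_coordinates.

(* Main.v *)
(** In a product chart the metric is block diagonal, with blocks [g_ij(x)] and
    [f^2 g_ab(u)].  As [f] does not vary along the first factor, its only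
    nonzero Christoffel symbols are those of [g_ij], and [F^c_ab + N^c_ab].  The
    latter do not vary along the first factor either, so every mixed component
    of the curvature vanishes; the purely first components are those of [M1],
    and expanding the products in the purely second ones gives the curvature of
    [M2] minus the right-hand side of the formula. *)

Require Import Defs.
From mathcomp Require Import all_boot all_order all_algebra.
From mathcomp Require Import all_classical all_reals all_analysis.
From mathcomp Require Import ring.

Set Implicit Arguments.
Unset Strict Implicit.
Unset Printing Implicit Defensive.

Import Order.TTheory GRing.Theory Num.Theory.
Import numFieldNormedType.Exports.

Local Open Scope classical_set_scope.
Local Open Scope ring_scope.

(** * Smooth functions on an open set: closure properties and rules for partial derivatives *)

Section smooth_functions.
Context {R : realType} {n : nat} (D : set 'rV[R]_n).
Context (oD : open D).
Implicit Types h k : 'rV[R]_n -> R.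

Lemma smooth_on_derivable h x a :
  smooth_on D h -> D x -> derivable h x (delta_mx 0 a).
Proof. by move=> /(_ 1) [_ /(_ a) [hd _]] /hd. Qed.

Lemma smooth_on_partial h a : smooth_on D h -> smooth_on D (partial a h).
Proof. by move=> hs m; have [_ /(_ a) []] := hs m.+1. Qed.

Lemma smooth_on_ext h k : (forall x, D x -> h x = k x) ->
  smooth_on D h -> smooth_on D k.
Proof. by move=> hk hs m; exact: Ck_on_ext hk (hs m). Qed.

Lemma smooth_onD h k : smooth_on D h -> smooth_on D k ->
  smooth_on D (fun x => h x + k x).
Proof. by move=> hs ks m; exact: Ck_onD. Qed.

Lemma smooth_onM h k : smooth_on D h -> smooth_on D k ->
  smooth_on D (fun x => h x * k x).
Proof. by move=> hs ks m; exact: Ck_onM. Qed.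

Lemma smooth_on_cst c : smooth_on D (fun=> c).
Proof. by move=> m; exact: Ck_on_cst. Qed.

Lemma smooth_onB h k : smooth_on D h -> smooth_on D k ->
  smooth_on D (fun x => h x - k x).
Proof.
move=> hs ks; apply: smooth_onD => //.
under eq_fun do rewrite -mulN1r.
by apply: smooth_onM => //; exact: smooth_on_cst.
Qed.

Lemma smooth_on_sum (I : Type) (r : seq I) (P : pred I)
    (F : I -> 'rV[R]_n -> R) : (forall i, P i -> smooth_on D (F i)) ->
  smooth_on D (fun x => \sum_(i <- r | P i) F i x).
Proof.
move=> Fs; elim: r => [|i r IH].
  by under eq_fun do rewrite big_nil; exact: smooth_on_cst.
have [Pi|/negPf Pi] := boolP (P i); last first.
  by under eq_fun do rewrite big_cons Pi.
under eq_fun do rewrite big_cons Pi.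
by apply: smooth_onD => //; exact: Fs.
Qed.

Lemma smooth_on_prod (I : Type) (r : seq I) (P : pred I)
    (F : I -> 'rV[R]_n -> R) : (forall i, P i -> smooth_on D (F i)) ->
  smooth_on D (fun x => \prod_(i <- r | P i) F i x).
Proof.
move=> Fs; elim: r => [|i r IH].
  by under eq_fun do rewrite big_nil; exact: smooth_on_cst.
have [Pi|/negPf Pi] := boolP (P i); last first.
  by under eq_fun do rewrite big_cons Pi.
under eq_fun do rewrite big_cons Pi.
by apply: smooth_onM => //; exact: Fs.
Qed.

(** Induction on the order of differentiability, with [h] smooth throughout: the partial derivative
    of the inverse is a product of two copies of the inverse itself, covered by the induction
    hypothesis, and a partial derivative of [h]. *)
Lemma smooth_onV h : (forall x, D x -> h x != 0) -> smooth_on D h ->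
  smooth_on D (fun x => (h x)^-1).
Proof.
move=> h0 hs; elim=> [|m IH].
  by split=> // x Dx; apply: continuousV; [exact: h0|exact: (Ck_on_cont (hs 0))].
split=> [x Dx|a].
  by apply: continuousV; [exact: h0|exact: (Ck_on_cont (hs 0))].
split=> [x Dx|].
  by apply: derivableV; [exact: h0|exact: smooth_on_derivable].
apply: (@Ck_on_ext _ _ _ _
  (fun x => -1 * ((h x)^-1 * (h x)^-1) * partial a h x)) => //.
  move=> x Dx; rewrite /partial deriveV; [|exact: h0|exact: smooth_on_derivable].
  by rewrite mulN1r -expr2 exprVn.
apply: Ck_onM => //; last exact: smooth_on_partial.
by apply: Ck_onM => //; [exact: Ck_on_cst|exact: Ck_onM].
Qed.

Lemma smooth_on_det m (A : 'rV[R]_n -> 'M[R]_m) :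
  (forall i j, smooth_on D (fun x => A x i j)) -> smooth_on D (fun x => \det (A x)).
Proof.
move=> As; apply: smooth_on_sum => s _; apply: smooth_onM.
  exact: smooth_on_cst.
by apply: smooth_on_prod => i _.
Qed.

(** Cramer's rule: an entry of the inverse is a cofactor divided by the determinant, and both are
    polynomials in the entries of [A]. *)
Lemma smooth_on_invmx m (A : 'rV[R]_n -> 'M[R]_m) i j :
  (forall x, D x -> A x \in unitmx) ->
  (forall i j, smooth_on D (fun x => A x i j)) ->
  smooth_on D (fun x => invmx (A x) i j).
Proof.
move=> Au As.
apply: (@smooth_on_ext (fun x => (\det (A x))^-1 * cofactor (A x) j i)).
  by move=> x Dx; rewrite /invmx Au// !mxE.
apply: smooth_onM.
  apply: smooth_onV; last exact: smooth_on_det.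
  by move=> x /Au; rewrite unitmxE unitfE.
apply: smooth_onM; first exact: smooth_on_cst.
apply: smooth_on_det => k l; under eq_fun do rewrite !mxE.
exact: As.
Qed.

Lemma smooth_on_christoffel (g : 'rV[R]_n -> 'M[R]_n) c a b :
  (forall x, D x -> g x \in unitmx) ->
  (forall i j, smooth_on D (fun x => g x i j)) ->
  smooth_on D (fun x => christoffel g x c a b).
Proof.
move=> gu gs; apply: smooth_onM; first exact: smooth_on_cst.
apply: smooth_on_sum => d _; apply: smooth_onM; first exact: smooth_on_invmx.
by apply: smooth_onB; [apply: smooth_onD|]; exact: smooth_on_partial.
Qed.

Lemma partial_ext h k x a : (forall y, D y -> h y = k y) -> D x ->
  partial a h x = partial a k x.
Proof.
move=> hk Dx; apply: near_eq_derive.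
by have := open_nbhs_nbhs (conj oD Dx); apply: filterS => y /hk.
Qed.

Lemma partialD h k x a : smooth_on D h -> smooth_on D k -> D x ->
  partial a (fun y => h y + k y) x = partial a h x + partial a k x.
Proof. by move=> hs ks Dx; apply: deriveD; exact: smooth_on_derivable. Qed.

Lemma partialM h k x a : smooth_on D h -> smooth_on D k -> D x ->
  partial a (fun y => h y * k y) x = h x * partial a k x + k x * partial a h x.
Proof. by move=> hs ks Dx; apply: deriveM; exact: smooth_on_derivable. Qed.

Lemma partial_cst c x a : partial a (fun _ : 'rV[R]_n => c) x = 0.
Proof. exact: derive_cst. Qed.

End smooth_functions.

(** * Functions whose derivative along a fixed direction vanishes *)

Section invariance_along_a_direction.
Context {R : realType} {V : normedModType R}.
Implicit Types (h : V -> R) (z v w : V).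

Let is_derive_line h z v (s : R) : derivable h (z + s *: v) v ->
  is_derive s 1 (fun r : R => h (z + r *: v)) ('D_v h (z + s *: v)).
Proof.
have E : (fun r : R => r^-1 *:
      (((fun r : R => h (z + r *: v)) \o shift s) (r *: 1) - h (z + s *: v))) =
    (fun r => r^-1 *: ((h \o shift (z + s *: v)) (r *: v) - h (z + s *: v))).
  apply/funext => r /=; congr (_ *: (h _ - _)).
  by rewrite scalerDl addrCA [r *: 1]mulr1.
by move=> hd; split; rewrite /derivable /derive E.
Qed.

(** This is the mean value theorem for the restriction of [h] to the segment, with derivative
    constantly 0. *)
Lemma derive0_segment h z v (t : R) : 0 <= t ->
  (forall s, 0 <= s <= t -> derivable h (z + s *: v) v /\ 'D_v h (z + s *: v) = 0) ->
  h (z + t *: v) = h z.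
Proof.
move=> t0 hd.
have hder s : 0 <= s <= t -> is_derive s 1 (fun r : R => h (z + r *: v)) 0.
  by move=> /hd [d <-]; exact: is_derive_line.
have [] := @MVT_segment R (fun r => h (z + r *: v)) (fun=> 0) 0 t t0.
- by move=> s; rewrite in_itv/= => /andP[s0 st]; apply: hder; rewrite !ltW.
- apply: derivable_within_continuous => s; rewrite in_itv/= => st.
  by have [] := hder s st.
- by move=> c _; rewrite mul0r scale0r addr0 => /eqP; rewrite subr_eq0 => /eqP.
Qed.

(** The same small [t] serves for all [y] near [z]. Hence [h] and its translate by [t *: v] coincide
    on a neighbourhood of [z], not merely at [z], and their derivatives in any direction agree there
    too. *)
Lemma derive0_invariant (D : set V) h v : open D ->
  (forall z, D z -> derivable h z v /\ 'D_v h z = 0) ->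
  forall z, D z -> \forall t \near (0 : R), \forall y \near z, h (y + t *: v) = h y.
Proof.
move=> oD hd z Dz.
have cont : {for (z, 0 : R), continuous (fun p : V * R => p.1 + p.2 *: v)}.
  apply: (@cvgD _ _ _ _ _ (fun p : V * R => p.1) (fun p : V * R => p.2 *: v)).
    exact: cvg_fst.
  by apply: cvgZr_tmp; exact: cvg_snd.
(* Continuity of [(y, s) |-> y + s *: v] at [(z, 0)] gives a neighbourhood [A] of [z] and a radius
   [e] such that all segments of length parameter below [e] starting in [A] stay in [D]. *)
have /cont [[A B] /= [Az [e /= e0 Be]] AB] : nbhs (z + 0 *: v) D.
  by rewrite scale0r addr0; exact: open_nbhs_nbhs.
have seg y s : A y -> `|s| < e -> D (y + s *: v).
  by move=> Ay se; apply: (AB (y, s)); split=> //; apply: Be; rewrite /= sub0r normrN.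
near=> t.
have te : `|t| < e.
  by near: t; exists e => // r /=; rewrite sub0r normrN.
apply: filterS Az => y Ay; have [t0|t0] := leP 0 t.
  apply: derive0_segment => // s /andP[s0 st]; apply: hd; apply: seg => //.
  by rewrite ger0_norm// (le_lt_trans st)// -(ger0_norm t0).
(* For negative [t] the segment is run backwards, from [y + t *: v] to [y], so that its parameter
   [- t] is nonnegative. *)
have -> : h y = h ((y + t *: v) + (- t) *: v) by rewrite scaleNr addrK.
apply/esym; apply: derive0_segment; first by rewrite oppr_ge0 ltW.
move=> s /andP[s0 st]; rewrite -addrA -scalerDl; apply: hd; apply: seg => //.
rewrite ler0_norm -?lerBrDl ?sub0r // opprD.
by rewrite (le_lt_trans _ te)// ltr0_norm// gerDl oppr_le0.
Unshelve. all: by end_near. Qed.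

Lemma derive_shift h z v w : 'D_w (fun y => h (y + v)) z = 'D_w h (z + v).
Proof.
rewrite /derive; set F := (fun _ : R => _); set G := (fun _ : R => _).
by suff -> : F = G by []; apply/funext => r; rewrite /F /G /= addrA.
Qed.

Lemma derive_invariant h z v :
  (\forall t \near (0 : R), h (z + t *: v) = h z) -> 'D_v h z = 0.
Proof.
move=> hz; apply: cvg_lim => //; apply: cvg_near_cst; apply: nbhs_dnbhs.
by apply: filterS hz => t /= tz; rewrite [_ + z]addrC tz subrr scaler0.
Qed.

End invariance_along_a_direction.

(** * The twisted metric in one product chart: its derivatives and its inverse *)

Section twisted_metric.
Context {R : realType} {n1 n2 : nat}.
Local Notation V := 'rV[R]_(n1 + n2).
Context (D1 : set 'rV[R]_n1) (D2 : set 'rV[R]_n2).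
Context (g1 : 'rV[R]_n1 -> 'M[R]_n1) (g2 : 'rV[R]_n2 -> 'M[R]_n2) (h : V -> R).

Definition prod_domain : set V := [set z | D1 (lsubmx z) /\ D2 (rsubmx z)].

(** With [h] the local expression of the twisting function, this is convertible to the metric of
    [twisted_product] in a product chart, so results on it transfer without rewriting. *)
Definition twisted_metric (z : V) : 'M[R]_(n1 + n2) :=
  block_mx (g1 (lsubmx z)) 0 0 (h z ^+ 2 *: g2 (rsubmx z)).

Local Notation D := prod_domain.
Local Notation G := twisted_metric.

Context (oD1 : open D1) (oD2 : open D2).
Context (g1_unit : forall x, D1 x -> g1 x \in unitmx).
Context (g2_unit : forall u, D2 u -> g2 u \in unitmx).
Context (g2_sym : forall u, D2 u -> (g2 u)^T = g2 u).
Context (g2_smooth : forall a b, smooth_on D2 (fun u => g2 u a b)).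
Context (h_neq0 : forall z, D z -> h z != 0) (h_smooth : smooth_on D h).
Context (h_partial_l : forall z, D z -> forall i, partial (lshift n2 i) h z = 0).

Lemma open_prod_domain : open D.
Proof.
apply: (@openI _ (lsubmx @^-1` D1) (rsubmx @^-1` D2)).
- by apply: open_comp => // z _; exact: continuous_lsubmx.
- by apply: open_comp => // z _; exact: continuous_rsubmx.
Qed.
Let oD := open_prod_domain.

Lemma smooth_on_prod_r (k : 'rV[R]_n2 -> R) : smooth_on D2 k ->
  smooth_on D (fun z : V => k (rsubmx z)).
Proof.
by move=> ks m; apply: Ck_onS (smooth_on_rsubmx ks m) => z [].
Qed.

Lemma partial_metric_ll_l a b c z : partial (lshift n2 c)
  (fun z => G z (lshift n2 a) (lshift n2 b)) z =
  partial c (fun x => g1 x a b) (lsubmx z).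
Proof.
under eq_fun do rewrite block_mxEul.
exact: (partial_lsubmx_l c (fun x => g1 x a b)).
Qed.

Lemma partial_metric_ll_r a b c z : partial (rshift n1 c)
  (fun z => G z (lshift n2 a) (lshift n2 b)) z = 0.
Proof.
under eq_fun do rewrite block_mxEul.
exact: (partial_lsubmx_r c (fun x => g1 x a b)).
Qed.

Lemma partial_metric_lr a b c z :
  partial c (fun z => G z (lshift n2 a) (rshift n1 b)) z = 0.
Proof. by under eq_fun do rewrite block_mxEur mxE; exact: partial_cst. Qed.

Lemma partial_metric_rl a b c z :
  partial c (fun z => G z (rshift n1 a) (lshift n2 b)) z = 0.
Proof. by under eq_fun do rewrite block_mxEdl mxE; exact: partial_cst. Qed.

Let partial_metric_rr a b c z : D z ->
  partial c (fun z => G z (rshift n1 a) (rshift n1 b)) z =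
  h z ^+ 2 * partial c (fun z : V => g2 (rsubmx z) a b) z
  + g2 (rsubmx z) a b * (2 * h z * partial c h z).
Proof.
move=> Dz; under eq_fun do rewrite block_mxEdr mxE expr2.
have gs : smooth_on D (fun z : V => g2 (rsubmx z) a b).
  exact: (smooth_on_prod_r (g2_smooth a b)).
rewrite (partialM c (smooth_onM oD h_smooth h_smooth) gs)//.
by rewrite (partialM c h_smooth h_smooth)//; ring.
Qed.

Lemma partial_metric_rr_l a b c z : D z ->
  partial (lshift n2 c) (fun z => G z (rshift n1 a) (rshift n1 b)) z = 0.
Proof.
move=> Dz; rewrite partial_metric_rr// h_partial_l//.
by rewrite (partial_rsubmx_l c (fun u => g2 u a b)) !mulr0 addr0.
Qed.

Lemma partial_metric_rr_r a b c z : D z ->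
  partial (rshift n1 c) (fun z => G z (rshift n1 a) (rshift n1 b)) z =
  h z ^+ 2 * partial c (fun u => g2 u a b) (rsubmx z)
  + g2 (rsubmx z) a b * (2 * h z * partial (rshift n1 c) h z).
Proof.
by move=> Dz; rewrite partial_metric_rr// (partial_rsubmx_r c (fun u => g2 u a b)).
Qed.

Lemma invmx_twisted_metric z : D z -> invmx (G z) =
  block_mx (invmx (g1 (lsubmx z))) 0 0 ((h z ^+ 2)^-1 *: invmx (g2 (rsubmx z))).
Proof.
move=> Dz; have [D1z D2z] := Dz.
have h2 : h z ^+ 2 \is a GRing.unit by rewrite unitfE expf_neq0// h_neq0.
rewrite invmx_block_diag ?invmxZ ?unitmxZ ?g2_unit//.
by rewrite unitmxE det_ublock unitrM -!unitmxE g1_unit// unitmxZ// g2_unit.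
Qed.

(** * Christoffel symbols of the twisted metric and their first derivatives *)

Lemma christoffel_lll z c a b : D z ->
  christoffel G z (lshift n2 c) (lshift n2 a) (lshift n2 b) =
  christoffel g1 (lsubmx z) c a b.
Proof.
move=> Dz; rewrite /christoffel invmx_twisted_metric// big_split_ord /=.
rewrite [X in _ + X]big1 ?addr0; last by move=> d _; rewrite block_mxEur mxE mul0r.
by congr (_ * _); apply: eq_bigr => d _; rewrite block_mxEul !partial_metric_ll_l.
Qed.

(** The product rule splits each derivative of [h ^+ 2 * g2] in two. The part differentiating [g2]
    keeps the factor [h ^+ 2], which cancels against the inverse metric and leaves the symbols of
    [g2]. The part differentiating [h ^+ 2] carries [2 * h], which reduces to the factor [h^-1] of
    the twist tensor. *)
Lemma christoffel_rrr z c a b : D z ->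
  christoffel G z (rshift n1 c) (rshift n1 a) (rshift n1 b) =
  christoffel g2 (rsubmx z) c a b + twist_tensor h g2 z c a b.
Proof.
move=> Dz; rewrite /christoffel invmx_twisted_metric// big_split_ord /=.
rewrite [X in X + _]big1 ?add0r; last by move=> d _; rewrite block_mxEdl mxE mul0r.
have [D1z D2z] := Dz.
set u := rsubmx z; pose fd l := partial (rshift n1 l) h z.
have hz := h_neq0 Dz.
(* The contraction runs over the second index of [g2], so its symmetry is needed to recognise a
   matrix product. These sums become the Kronecker deltas of the twist tensor. *)
have delta e : \sum_d invmx (g2 u) c d * g2 u e d = (c == e)%:R.
  rewrite -[RHS](@mxE R n2 n2 matrix_key (fun i j => (i == j)%:R)).
  have := mulVmx (g2_unit D2z) => /matrixP /(_ c e); rewrite !mxE => <-.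
  by apply: eq_bigr => d _; rewrite -[in g2 u e d](g2_sym D2z) mxE.
transitivity (\sum_d (2^-1 * (invmx (g2 u) c d *
    (partial a (fun u => g2 u b d) u + partial b (fun u => g2 u a d) u
      - partial d (fun u => g2 u a b) u))
    + (h z)^-1 * (fd b * (invmx (g2 u) c d * g2 u a d)
        + fd a * (invmx (g2 u) c d * g2 u b d)
        - fd d * invmx (g2 u) c d * g2 u a b))).
  rewrite mulr_sumr; apply: eq_bigr => d _.
  by rewrite block_mxEdr mxE !partial_metric_rr_r// /fd -/u; field.
rewrite big_split /= -!mulr_sumr; congr (_ + _ * _).
by rewrite sumrB big_split /= -!mulr_sumr !delta.
Qed.

(** The inverse metric is block diagonal, so only [d] in the block of the upper index counts. Each
    remaining term differentiates either an off-diagonal block, which is 0, or a diagonal block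
    along the other factor. For the second block the latter vanishes because [h] does not vary along
    the first factor. *)
Lemma christoffel_mixed z : D z ->
  (forall c a b, christoffel G z (lshift n2 c) (lshift n2 a) (rshift n1 b) = 0) *
  (forall c a b, christoffel G z (lshift n2 c) (rshift n1 a) (lshift n2 b) = 0) *
  (forall c a b, christoffel G z (lshift n2 c) (rshift n1 a) (rshift n1 b) = 0) *
  (forall c a b, christoffel G z (rshift n1 c) (lshift n2 a) (lshift n2 b) = 0) *
  (forall c a b, christoffel G z (rshift n1 c) (lshift n2 a) (rshift n1 b) = 0) *
  (forall c a b, christoffel G z (rshift n1 c) (rshift n1 a) (lshift n2 b) = 0).
Proof.
move=> Dz; do !split; move=> c a b; rewrite /christoffel invmx_twisted_metric//;
  rewrite big_split_ord /= !big1 ?addr0 ?mulr0// => d _;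
  rewrite ?block_mxEul ?block_mxEur ?block_mxEdl ?block_mxEdr;
  rewrite ?(partial_metric_ll_r, partial_metric_lr, partial_metric_rl,
    partial_metric_rr_l)//;
  by rewrite ?(mxE, addr0, subr0, mulr0, mul0r).
Qed.

Lemma partial_christoffel_mixed d z : D z ->
  (forall c a b, partial d (fun z =>
     christoffel G z (lshift n2 c) (lshift n2 a) (rshift n1 b)) z = 0) *
  (forall c a b, partial d (fun z =>
     christoffel G z (lshift n2 c) (rshift n1 a) (lshift n2 b)) z = 0) *
  (forall c a b, partial d (fun z =>
     christoffel G z (lshift n2 c) (rshift n1 a) (rshift n1 b)) z = 0) *
  (forall c a b, partial d (fun z =>
     christoffel G z (rshift n1 c) (lshift n2 a) (lshift n2 b)) z = 0) *
  (forall c a b, partial d (fun z =>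
     christoffel G z (rshift n1 c) (lshift n2 a) (rshift n1 b)) z = 0) *
  (forall c a b, partial d (fun z =>
     christoffel G z (rshift n1 c) (rshift n1 a) (lshift n2 b)) z = 0).
Proof.
move=> Dz; do !split; move=> c a b; rewrite -[RHS](partial_cst 0 z d);
  by apply: (partial_ext oD _ _ Dz) => y Dy; rewrite (christoffel_mixed Dy).
Qed.

Lemma partial_christoffel_lll_l d c a b z : D z ->
  partial (lshift n2 d) (fun z =>
    christoffel G z (lshift n2 c) (lshift n2 a) (lshift n2 b)) z =
  partial d (fun x => christoffel g1 x c a b) (lsubmx z).
Proof.
move=> Dz; rewrite -(partial_lsubmx_l d (fun x => christoffel g1 x c a b)).
by apply: (partial_ext oD _ _ Dz) => y Dy; rewrite christoffel_lll.
Qed.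

Lemma partial_christoffel_lll_r d c a b z : D z ->
  partial (rshift n1 d) (fun z =>
    christoffel G z (lshift n2 c) (lshift n2 a) (lshift n2 b)) z = 0.
Proof.
move=> Dz; rewrite -(partial_lsubmx_r d (fun x => christoffel g1 x c a b) z).
by apply: (partial_ext oD _ _ Dz) => y Dy; rewrite christoffel_lll.
Qed.

Lemma smooth_on_twist_tensor c a b : smooth_on D (fun z => twist_tensor h g2 z c a b).
Proof.
have fs l : smooth_on D (partial (rshift n1 l) h) by exact: smooth_on_partial.
have gs i j : smooth_on D (fun z : V => g2 (rsubmx z) i j).
  exact: (smooth_on_prod_r (g2_smooth i j)).
have gV i j : smooth_on D (fun z : V => invmx (g2 (rsubmx z)) i j).
  by apply: smooth_on_invmx => // z [_ /g2_unit].
apply: smooth_onM => //; first exact: smooth_onV.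
apply: smooth_onB => //.
  by apply: smooth_onD => //; apply: smooth_onM => //; exact: smooth_on_cst.
by apply: smooth_on_sum => // l _; do 2 apply: smooth_onM => //.
Qed.

Lemma partial_christoffel_rrr_r d c a b z : D z ->
  partial (rshift n1 d) (fun z =>
    christoffel G z (rshift n1 c) (rshift n1 a) (rshift n1 b)) z =
  partial d (fun u => christoffel g2 u c a b) (rsubmx z)
  + partial (rshift n1 d) (fun z => twist_tensor h g2 z c a b) z.
Proof.
move=> Dz; rewrite -(partial_rsubmx_r d (fun u => christoffel g2 u c a b)).
rewrite -(partialD _ _ (smooth_on_twist_tensor c a b) Dz).
  by apply: (partial_ext oD _ _ Dz) => y Dy; rewrite christoffel_rrr.
exact: (smooth_on_prod_r (smooth_on_christoffel oD2 c a b g2_unit g2_smooth)).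
Qed.

(* [h] is locally invariant under translations along the first factor, so its
   derivatives are too; no symmetry of second derivatives is needed. *)
Lemma partial_christoffel_rrr_l d c a b z : D z ->
  partial (lshift n2 d) (fun z =>
    christoffel G z (rshift n1 c) (rshift n1 a) (rshift n1 b)) z = 0.
Proof.
move=> Dz; set v : V := delta_mx 0 (lshift n2 d).
transitivity (partial (lshift n2 d) (fun z : V =>
    christoffel g2 (rsubmx z) c a b + twist_tensor h g2 z c a b) z).
  by apply: (partial_ext oD _ _ Dz) => y Dy; rewrite christoffel_rrr.
apply: derive_invariant.
have : \forall t \near (0 : R), \forall y \near z, h (y + t *: v) = h y.
  apply: (@derive0_invariant _ _ D) => // y Dy.
  by split; [exact: smooth_on_derivable h_smooth Dy|exact: h_partial_l].
apply: filterS => t tz.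
have rz : rsubmx (z + t *: v) = rsubmx z.
  by rewrite linearD linearZ /= rsubmx_delta_l scaler0 addr0.
have hz : h (z + t *: v) = h z := nbhs_singleton tz.
have dz l : partial (rshift n1 l) h (z + t *: v) = partial (rshift n1 l) h z.
  by rewrite /partial -derive_shift; exact: near_eq_derive.
rewrite /twist_tensor rz hz !dz; congr (_ + _ * (_ - _)).
by apply: eq_bigr => l _; rewrite dz.
Qed.

(** The expression in braces of the curvature formula, before [b] and [l] are interchanged and
    subtracted. A plain partial derivative stands for the horizontal one, as the twist tensor
    depends on position only. *)
Definition twist_curvature (z : V) (a c b l : 'I_n2) : R :=
  partial (rshift n1 b) (fun z => twist_tensor h g2 z c a l) z
  + \sum_m christoffel g2 (rsubmx z) c b m * twist_tensor h g2 z m a l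
  + \sum_m twist_tensor h g2 z c b m * christoffel g2 (rsubmx z) m a l
  + \sum_m twist_tensor h g2 z c b m * twist_tensor h g2 z m a l.

(** * Components of the curvature tensor of the twisted metric *)

Lemma curvature_llll z a c b l : D z ->
  curvature G z (lshift n2 a) (lshift n2 c) (lshift n2 b) (lshift n2 l) =
  curvature g1 (lsubmx z) a c b l.
Proof.
move=> Dz; rewrite /curvature !partial_christoffel_lll_l// !big_split_ord /=.
congr (_ + _ - _);
  (rewrite [X in _ + X]big1 ?addr0;
    last by move=> m _; rewrite !(christoffel_mixed Dz) mul0r);
  by apply: eq_bigr => m _; rewrite !christoffel_lll.
Qed.

(** Each product of two symbols F + N expands into FF, FN, NF and NN. The FF terms and the
    derivatives of F make up the curvature of [g2]. The rest is the twist part, with a minus sign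
    because the curvature convention counts the derivative along [b] negatively. *)
Lemma curvature_rrrr z a c b l : D z ->
  curvature G z (rshift n1 a) (rshift n1 c) (rshift n1 b) (rshift n1 l) =
  curvature g2 (rsubmx z) a c b l
  - (twist_curvature z a c b l - twist_curvature z a c l b).
Proof.
move=> Dz.
have prodE b' l' : \sum_m christoffel G z (rshift n1 c) (rshift n1 b') m
      * christoffel G z m (rshift n1 a) (rshift n1 l') =
    \sum_m christoffel g2 (rsubmx z) c b' m * christoffel g2 (rsubmx z) m a l'
    + \sum_m christoffel g2 (rsubmx z) c b' m * twist_tensor h g2 z m a l'
    + \sum_m twist_tensor h g2 z c b' m * christoffel g2 (rsubmx z) m a l'
    + \sum_m twist_tensor h g2 z c b' m * twist_tensor h g2 z m a l'.
  rewrite big_split_ord /= big1 ?add0r; last first.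
    by move=> m _; rewrite !(christoffel_mixed Dz) mul0r.
  rewrite -!big_split /=; apply: eq_bigr => m _.
  by rewrite !christoffel_rrr// mulrDl !mulrDr !addrA.
rewrite /curvature !partial_christoffel_rrr_r// !prodE /twist_curvature.
(* Only the eight distinct sums and four distinct derivatives matter: once they are made opaque, a
   linear identity remains. *)
do 8! [move: (\sum_m _) => ?]; do 4! [move: (partial _ _ _) => ?]; ring.
Qed.

Lemma twisted_metric_flatP z : D z ->
  (forall a c b l, curvature G z a c b l = 0) <->
  (forall a c b l, curvature g1 (lsubmx z) a c b l = 0) /\
  (forall a c b l, curvature g2 (rsubmx z) a c b l =
     twist_curvature z a c b l - twist_curvature z a c l b).
Proof.
move=> Dz; split=> [flatG|[flat1 curv2] a c b l].
  split=> a c b l; first by rewrite -curvature_llll.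
  by apply/eqP; rewrite -subr_eq0 -curvature_rrrr//; apply/eqP.
(* Placing each index in one of the two blocks gives sixteen cases; the two unmixed ones follow from
   the hypotheses. *)
rewrite -(splitK a) -(splitK b) -(splitK c) -(splitK l).
case: (fintype.split a) (fintype.split b) (fintype.split c) (fintype.split l)
  => {}a [] {}b [] {}c [] {}l /=;
  try by rewrite ?curvature_llll ?curvature_rrrr// curv2 subrr.
(* A nonzero symbol has its three indices in one block, and its derivative along the other block
   vanishes. A nonzero product of two symbols sharing [m] would force all four free indices into one
   block. *)
all: rewrite /curvature ?(partial_christoffel_mixed _ Dz, partial_christoffel_lll_r,
  partial_christoffel_rrr_l)// !big_split_ord /= !big1 ?subrr ?addr0 ?subr0// => m _;
  by rewrite ?(christoffel_mixed Dz, mulr0, mul0r).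
Qed.

End twisted_metric.

(** * From a single chart to the manifolds *)

Lemma posdef_unitmx (R : realFieldType) n (A : 'M[R]_n) :
  (forall v : 'rV[R]_n, v != 0 -> 0 < (v *m A *m v^T) 0 0) -> A \in unitmx.
Proof.
(* A vector of the left kernel annihilates the quadratic form, so positivity makes it 0. *)
move=> Apos; rewrite -row_free_unit -kermx_eq0; apply/rowV0P => v /sub_kermxP vA.
by apply/eqP; apply: contraT => /Apos; rewrite vA mul0mx mxE ltxx.
Qed.

Theorem theorem5 (R : realType) (n1 n2 : nat)
    (M1 : riemannian R n1) (M2 : riemannian R n2)
    (f : prod_manifold M1 M2 -> R)
    (f_smooth : smooth f) (f_gt0 : forall p, 0 < f p)
    (f_on_M2 : forall (k : mindex (prod_manifold M1 M2)) z,
       cimg (mchart k) z ->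
       forall i : 'I_n1, partial (lshift n2 i) (local f k) z = 0) :
  let M := twisted_product f_smooth f_gt0 in
  flat M <->
  flat M1 /\
  forall (k : mindex M) (z w : 'rV[R]_(n1 + n2)), cimg (mchart k) z ->
  forall alpha beta gamma lambda : 'I_n2,
    let u := rsubmx z in
    let g := metric k.2 in
    let F := christoffel g u in
    let N := twist_tensor (local f k) g in
    let E b l :=
      horizontal_u (finsler k) b (fun z' _ => N z' gamma alpha l) z w
      + \sum_mu F gamma b mu * N z mu alpha l
      + \sum_mu N z gamma b mu * F mu alpha l
      + \sum_mu N z gamma b mu * N z mu alpha l in
    curvature g u alpha gamma beta lambda = E beta lambda - E lambda beta.
Proof.
pose pos_unit n (N : riemannian R n) (i : mindex N) x (ix : cimg (mchart i) x) :=
  posdef_unitmx (metric_pos ix).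
have key (k : mindex (prod_manifold M1 M2)) z : cimg (mchart k) z ->
  (forall a c b l,
     curvature (twisted_metric (metric k.1) (metric k.2) (local f k)) z a c b l = 0)
  <-> (forall a c b l, curvature (metric k.1) (lsubmx z) a c b l = 0) /\
      (forall a c b l, curvature (metric k.2) (rsubmx z) a c b l =
        twist_curvature (metric k.2) (local f k) z a c b l
        - twist_curvature (metric k.2) (local f k) z a c l b).
  have kE : cimg (mchart k) =
      prod_domain (cimg (mchart k.1)) (cimg (mchart k.2)) by exact: cimg_prodE.
  rewrite kE; apply: twisted_metric_flatP; try exact: cimg_open.
  - exact: pos_unit.
  - exact: pos_unit.
  - by move=> u ku; exact: (Defs.metric_sym ku).
  - exact: metric_smooth.
  - by move=> y _; rewrite lt0r_neq0// f_gt0.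
  - by rewrite -kE; exact: f_smooth.
  - by rewrite -kE; exact: f_on_M2.
move=> M; split=> [flatM|[flat1 curv2] k z kz].
  split=> [i x ix|k z w kz al be ga la /=]; last first.
    have [_ curv2] := (key k z kz).1 (flatM k z kz).
    by rewrite !horizontal_u_base; exact: curv2.
  (* Flatness of [M1] at [x] is read off at a point of the product above [x], for which some point
     of [M2] must be supplied. *)
  have [q _] := mnonempty M2; have [j jq] := mcover q.
  pose z := row_mx x (cmap (mchart j) q).
  have kz : cimg (mchart ((i, j) : mindex M)) z.
    by rewrite cimg_prodE /= row_mxKl row_mxKr; split=> //; exists q.
  have [+ _] := (key (i, j) z kz).1 (flatM (i, j) z kz).
  by rewrite row_mxKl.
apply/(key k z kz); split=> [|al ga be la].
  by move: kz; rewrite cimg_prodE => -[/flat1].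
(* The fibre vector 0 is an arbitrary choice: the horizontal derivative of the twist tensor does not
   depend on it. *)
by have := curv2 k z 0 kz al be ga la; rewrite /= !horizontal_u_base.
Qed.
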